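(* Let $\Pi$ be any epistemic program (a set of rules as defined in the context). A belief view $\mathcal{W}$ (a set of propositional interpretations) is an equilibrium world view of $\Pi$ if and only if $\mathcal{W}$ is a G91-world view of $\Pi$ and $\mathcal{W}$ is founded with respect to $\Pi$.
   Context: Fix a set $\mathrm{At}$ of atoms. Formulas: $\varphi ::= \bot \mid a \mid \varphi_1\wedge\varphi_2 \mid \varphi_1\vee\varphi_2\mid \varphi_1\to\varphi_2 \mid \mathbf{L}\varphi$ ($a\in\mathrm{At}$); $\neg\varphi := \varphi\to\bot$, $\top:=\neg\bot$, $\varphi\leftarrow\psi := \psi\to\varphi$. A theory is a set of formulas. Classical/KD45 part. A propositional interpretation is a set $I\subseteq\mathrm{At}$. A belief view $\mathcal{W}$ is a set of propositional interpretations. Satisfaction $\langle\mathcal{W},I\rangle\models\varphi$ is classical for $\bot,\wedge,\vee,\to$ (with $\langle\mathcal W,I\rangle\models a$ iff $a\in I$), and $\langle\mathcal{W},I\rangle\models\mathbf{L}\psi$ iff $\langle\mathcal{W},J\rangle\models\psi$ for all $J\in\mathcal{W}$. Write $\mathcal W\models\mathbf L\psi$ when this holds. The subjective reduct $\Gamma^{\mathcal W}$ of a theory $\Gamma$ replaces every maximal subformula $\mathbf{L}\psi$ by $\top$ if $\mathcal{W}\models\mathbf{L}\psi$ and by $\bot$ otherwise. Here-and-There (HT). An HT-interpretation is a pair $\langle H,T\rangle$ with $H\subseteq T\subseteq\mathrm{At}$; for $\mathbf L$-free formulas: $\langle H,T\rangle\not\models\bot$; $\langle H,T\rangle\models p$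 iff $p\in H$; $\wedge,\vee$ componentwise; $\langle H,T\rangle\models\varphi\to\psi$ iff $T\models\varphi\to\psi$ classically and ($\langle H,T\rangle\not\models\varphi$ or $\langle H,T\rangle\models\psi$). $T$ is a stable model of an $\mathbf L$-free theory $\Gamma$ iff $T\models\Gamma$ classically and there is no $H\subsetneq T$ with $\langle H,T\rangle\models\Gamma$; $\mathrm{SM}[\Gamma]$ is the set of stable models. $\mathcal W$ is a G91-world view of $\Gamma$ iff $\mathcal{W}=\mathrm{SM}[\Gamma^{\mathcal W}]$. Programs. An objective literal is $a$, $\neg a$ or $\neg\neg a$ ($a\in\mathrm{At}$); a subjective literal is $\mathbf L l$, $\neg\mathbf L l$ or $\neg\neg\mathbf L l$ with $l$ an objective literal; a literal is positive if it contains no negation. A rule is $a_1\vee\dots\vee a_n\leftarrow B_1\wedge\dots\wedge B_m$ ($n,m\ge0$, $n+m>0$, $a_i$ atoms, $B_j$ literals); $\mathrm{Head}(r)=\{a_1,\dots,a_n\}$ (the formula $\bot$ if $n=0$), $\mathrm{Body}(r)=B_1\wedge\dots\wedge B_m$ ($\top$ if $m=0$); $\mathrm{Body}^+_{ob}(r)$ is the set of atoms $a$ such that $a$ is one of the $B_j$; $\mathrm{Body}^+_{sub}(r)$ is the set of atoms $a$ such that $\mathbf L a$ is one of the $B_j$. A program is a set of rules. Foundedness. Given program $\Pi$ and belief view $\mathcal W$, an unfounded set is a non-empty set $\mathcal U$ of pairs $\langle X,I\rangle$ of sets of atoms such that, letting $Y=\bigcup\{X' : \langle X',I'\rangle\in\mathcal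 U\}$, for every $\langle X,I\rangle\in\mathcal U$ there is no rule $r\in\Pi$ with $\mathrm{Head}(r)\cap X\neq\emptyset$ satisfying all of: (1) $\langle\mathcal W,I\rangle\models\mathrm{Body}(r)$; (2) $\mathrm{Body}^+_{ob}(r)\cap X=\emptyset$; (3) $(\mathrm{Head}(r)\setminus X)\cap I=\emptyset$; (4) $\mathrm{Body}^+_{sub}(r)\cap Y=\emptyset$. $\mathcal W$ is unfounded (w.r.t. $\Pi$) if there is an unfounded set $\mathcal U$ such that every $\langle X,I\rangle\in\mathcal U$ has $I\in\mathcal W$ and $X\cap I\neq\emptyset$; otherwise $\mathcal W$ is founded. FAEEL. An HT belief view is a non-empty set $\mathcal W$ of HT-interpretations; $\mathcal W^t=\{T_i:\langle H_i,T_i\rangle\in\mathcal W\}$; $\mathcal W$ is total if $H_i=T_i$ for all members (identified with a set of interpretations). For a belief interpretation $\mathcal I=\langle \mathcal W,H,T\rangle$ ($H\subseteq T$): $\mathcal I\not\models\bot$; $\mathcal I\models a$ iff $a\in H$; $\wedge,\vee$ componentwise; $\mathcal I\models\psi_1\to\psi_2$ iff (i) $\mathcal I\not\models\psi_1$ or $\mathcal I\models\psi_2$, and (ii) $\langle\mathcal W^t,T\rangle\not\models\psi_1$ or $\langle\mathcal W^t,T\rangle\models\psi_2$ (the latter being the same definition applied to the total interpretation $\langle\mathcal W^t,T,T\rangle$); $\mathcal I\models\mathbf L\psi$ iff $\langle\mathcal W,H_i,T_i\rangle\models\psi$ for all $\langle H_i,T_i\rangle\in\mathcal W$. $\langle\mathcal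 W,H,T\rangle$ is a belief model of $\Gamma$ iff $\langle\mathcal W,H_i,T_i\rangle\models\varphi$ for all $\varphi\in\Gamma$ and all $\langle H_i,T_i\rangle\in\mathcal W\cup\{\langle H,T\rangle\}$. Order: $\langle\mathcal W',H',T'\rangle\preceq\langle\mathcal W,H,T\rangle$ iff $T'=T$, $H'\subseteq H$, for every $\langle H_i,T_i\rangle\in\mathcal W$ there is $\langle H_i',T_i\rangle\in\mathcal W'$ with $H_i'\subseteq H_i$, and for every $\langle H'_i,T_i\rangle\in\mathcal W'$ there is $\langle H_i,T_i\rangle\in\mathcal W$ with $H'_i\subseteq H_i$; $\prec$ is the strict version. A total belief interpretation $\langle\mathcal W,T,T\rangle$ (written $\langle\mathcal W,T\rangle$) is an equilibrium belief model of $\Gamma$ if it is a belief model of $\Gamma$ and no belief model $\mathcal I'$ of $\Gamma$ satisfies $\mathcal I'\prec\langle\mathcal W,T\rangle$; $\mathrm{EQB}[\Gamma]$ denotes their set. A (total) belief view $\mathcal W$ is an equilibrium world view of $\Gamma$ iff $\mathcal W=\{T : \langle\mathcal W,T\rangle\in\mathrm{EQB}[\Gamma]\}$.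
   Formalization: The belief view W is assumed non-empty, because equilibrium world views are only defined for non-empty belief views; for the empty W the equivalence fails (e.g. for the program ⊥←a, ⊥←¬a, where the empty view is a founded G91-world view). *)

(* Defs.v *)
From Stdlib Require List.
From mathcomp Require Import all_boot.
From mathcomp Require Import boolp classical_sets.

Set Implicit Arguments.
Unset Strict Implicit.
Unset Printing Implicit Defensive.

Local Open Scope classical_set_scope.

Inductive form (At : Type) : Type :=
| FBot
| FAtom of At
| FAnd of form At & form At
| FOr of form At & form At
| FImp of form At & form At
| FL of form At.
Arguments FBot {At}.

Definition FNeg (At : Type) (f : form At) : form At := FImp f FBot.
Definition FTop (At : Type) : form At := FNeg FBot.
Arguments FTop {At}.

(* L-free formulas, the target of the subjective reduct. *)
Inductive oform (At : Type) : Type :=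
| OBot
| OAtom of At
| OAnd of oform At & oform At
| OOr of oform At & oform At
| OImp of oform At & oform At.
Arguments OBot {At}.

Definition OTop (At : Type) : oform At := OImp OBot OBot.
Arguments OTop {At}.

Definition interp (At : Type) : Type := set At.
Definition belief_view (At : Type) : Type := set (interp At).
Definition theory (At : Type) : Type := set (form At).

Fixpoint sat (At : Type) (W : belief_view At) (I : interp At) (f : form At)
    {struct f} : Prop :=
  match f with
  | FBot => False
  | FAtom a => I a
  | FAnd f1 f2 => sat W I f1 /\ sat W I f2
  | FOr f1 f2 => sat W I f1 \/ sat W I f2
  | FImp f1 f2 => ~ sat W I f1 \/ sat W I f2
  | FL g => forall J, W J -> sat W J g
  end.

Definition sat_L (At : Type) (W : belief_view At) (f : form At) : Prop :=
  forall J, W J -> sat W J f.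

(* Recursion stops at FL, so exactly the maximal subformulas FL g are
   replaced. *)
Fixpoint reduct_form (At : Type) (W : belief_view At) (f : form At) : oform At :=
  match f with
  | FBot => OBot
  | FAtom a => OAtom a
  | FAnd f1 f2 => OAnd (reduct_form W f1) (reduct_form W f2)
  | FOr f1 f2 => OOr (reduct_form W f1) (reduct_form W f2)
  | FImp f1 f2 => OImp (reduct_form W f1) (reduct_form W f2)
  | FL g => if `[< sat_L W g >] then OTop else OBot
  end.

Definition reduct (At : Type) (W : belief_view At) (G : theory At) :
  set (oform At) := [set reduct_form W f | f in G].

Fixpoint osat (At : Type) (T : interp At) (f : oform At) : Prop :=
  match f with
  | OBot => False
  | OAtom a => T a
  | OAnd f1 f2 => osat T f1 /\ osat T f2
  | OOr f1 f2 => osat T f1 \/ osat T f2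
  | OImp f1 f2 => ~ osat T f1 \/ osat T f2
  end.

Fixpoint ht_sat (At : Type) (H T : interp At) (f : oform At) : Prop :=
  match f with
  | OBot => False
  | OAtom a => H a
  | OAnd f1 f2 => ht_sat H T f1 /\ ht_sat H T f2
  | OOr f1 f2 => ht_sat H T f1 \/ ht_sat H T f2
  | OImp f1 f2 => osat T (OImp f1 f2) /\ (~ ht_sat H T f1 \/ ht_sat H T f2)
  end.

Definition stable_model (At : Type) (G : set (oform At)) (T : interp At) : Prop :=
  (forall f, G f -> osat T f) /\
  ~ (exists H : interp At, H `<` T /\ forall f, G f -> ht_sat H T f).

Definition SM (At : Type) (G : set (oform At)) : belief_view At :=
  [set T | stable_model G T].

Definition G91_world_view (At : Type) (G : theory At) (W : belief_view At) : Prop :=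
  W = SM (reduct W G).

Inductive objlit (At : Type) : Type :=
| OLPos of At
| OLNeg of At
| OLNegNeg of At.

Inductive literal (At : Type) : Type :=
| LObj of objlit At
| LSub of objlit At
| LSubNeg of objlit At
| LSubNegNeg of objlit At.

Definition objlit_form (At : Type) (l : objlit At) : form At :=
  match l with
  | OLPos a => FAtom a
  | OLNeg a => FNeg (FAtom a)
  | OLNegNeg a => FNeg (FNeg (FAtom a))
  end.

Definition literal_form (At : Type) (B : literal At) : form At :=
  match B with
  | LObj l => objlit_form l
  | LSub l => FL (objlit_form l)
  | LSubNeg l => FNeg (FL (objlit_form l))
  | LSubNegNeg l => FNeg (FNeg (FL (objlit_form l)))
  end.

Record rule (At : Type) : Type := Rule {
  rule_head : seq At;
  rule_body : seq (literal At);
  rule_nonempty : (0 < size rule_head + size rule_body)%N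
}.

Definition program (At : Type) : Type := set (rule At).

Fixpoint big_or (At : Type) (s : seq (form At)) : form At :=
  match s with
  | [::] => FBot
  | [:: f] => f
  | f :: s' => FOr f (big_or s')
  end.

Fixpoint big_and (At : Type) (s : seq (form At)) : form At :=
  match s with
  | [::] => FTop
  | [:: f] => f
  | f :: s' => FAnd f (big_and s')
  end.

Definition head_form (At : Type) (r : rule At) : form At :=
  big_or (map (@FAtom At) (rule_head r)).

Definition body_form (At : Type) (r : rule At) : form At :=
  big_and (map (@literal_form At) (rule_body r)).

Definition rule_form (At : Type) (r : rule At) : form At :=
  FImp (body_form r) (head_form r).

Definition program_theory (At : Type) (P : program At) : theory At :=
  [set rule_form r | r in P].

Definition Head (At : Type) (r : rule At) : set At :=
  [set a | List.In a (rule_head r)].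

Definition Body_ob_pos (At : Type) (r : rule At) : set At :=
  [set a | List.In (LObj (OLPos a)) (rule_body r)].

Definition Body_sub_pos (At : Type) (r : rule At) : set At :=
  [set a | List.In (LSub (OLPos a)) (rule_body r)].

Definition unfounded_set (At : Type) (P : program At) (W : belief_view At)
    (U : set (set At * interp At)) : Prop :=
  let Y := \bigcup_(p in U) p.1 in
  U !=set0 /\
  forall X I, U (X, I) ->
    ~ exists r : rule At,
      [/\ P r & Head r `&` X !=set0] /\
      [/\ sat W I (body_form r),
          Body_ob_pos r `&` X = set0,
          (Head r `\` X) `&` I = set0
        & Body_sub_pos r `&` Y = set0].

Definition unfounded (At : Type) (P : program At) (W : belief_view At) : Prop :=
  exists U : set (set At * interp At),
    unfounded_set P W U /\
    forall X I, U (X, I) -> W I /\ X `&` I !=set0.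

Definition founded (At : Type) (P : program At) (W : belief_view At) : Prop :=
  ~ unfounded P W.

(* A pair (H, T) stands for <H,T>; the side condition H `<=` T and
   non-emptiness are imposed by [ht_belief_view] and [belief_interp]. *)
Definition ht_view (At : Type) : Type := set (interp At * interp At).

Definition ht_belief_view (At : Type) (W : ht_view At) : Prop :=
  W !=set0 /\ forall H T, W (H, T) -> H `<=` T.

Definition total_view (At : Type) (W : belief_view At) : ht_view At :=
  [set (T, T) | T in W].

Definition there_view (At : Type) (W : ht_view At) : belief_view At :=
  [set p.2 | p in W].

Fixpoint bsat (At : Type) (W : ht_view At) (H T : interp At) (f : form At)
    {struct f} : Prop :=
  match f with
  | FBot => False
  | FAtom a => H a
  | FAnd f1 f2 => bsat W H T f1 /\ bsat W H T f2
  | FOr f1 f2 => bsat W H T f1 \/ bsat W H T f2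
  | FImp f1 f2 =>
      (~ bsat W H T f1 \/ bsat W H T f2) /\
      (~ bsat (total_view (there_view W)) T T f1 \/
       bsat (total_view (there_view W)) T T f2)
  | FL g => forall Hi Ti, W (Hi, Ti) -> bsat W Hi Ti g
  end.

Record btriple (At : Type) : Type := BTriple {
  bview : ht_view At;
  bhere : interp At;
  bthere : interp At
}.

Definition belief_interp (At : Type) (I : btriple At) : Prop :=
  ht_belief_view (bview I) /\ bhere I `<=` bthere I.

Definition belief_model (At : Type) (G : theory At) (I : btriple At) : Prop :=
  belief_interp I /\
  forall f, G f -> forall Hi Ti,
    (bview I `|` [set (bhere I, bthere I)]) (Hi, Ti) -> bsat (bview I) Hi Ti f.

Definition ble (At : Type) (I' I : btriple At) : Prop :=
  [/\ bthere I' = bthere I,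
      bhere I' `<=` bhere I,
      forall Hi Ti, bview I (Hi, Ti) ->
        exists Hi', bview I' (Hi', Ti) /\ Hi' `<=` Hi
    & forall Hi' Ti, bview I' (Hi', Ti) ->
        exists Hi, bview I (Hi, Ti) /\ Hi' `<=` Hi].

Definition blt (At : Type) (I' I : btriple At) : Prop := ble I' I /\ I' <> I.

Definition total_btriple (At : Type) (W : belief_view At) (T : interp At) :
  btriple At := BTriple (total_view W) T T.

Definition EQB (At : Type) (G : theory At) : set (belief_view At * interp At) :=
  [set p | belief_model G (total_btriple p.1 p.2) /\
           ~ exists I', belief_model G I' /\ blt I' (total_btriple p.1 p.2)].

Definition equilibrium_world_view (At : Type) (G : theory At)
    (W : belief_view At) : Prop :=
  ht_belief_view (total_view W) /\ W = [set T | EQB G (W, T)].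

(* Main.v *)
(** If U witnesses that W is unfounded, adding the HT-interpretations
    <I \ X, I> for <X, I> in U to W yields a belief model strictly below <W, I>.
    Conversely, the non-total members <H, I> of a belief model strictly below
    <W, T> yield the unfounded set of all <I \ H, I>.  Both directions rest on
    the fact that, below a total view W, the body of a rule is believed at
    <H, T> iff it holds classically at <W, T>, its positive objective atoms lie
    in H, and its positive subjective atoms lie in every here-component. *)
Require Import Defs.
From mathcomp Require Import all_boot.
From mathcomp Require Import boolp classical_sets.

Local Open Scope classical_set_scope.

(** * Total views, classical satisfaction and the subjective reduct *)

Lemma there_total_view (At : Type) (W : belief_view At) :
  there_view (total_view W) = W.
Proof.
apply/seteqP; split=> T /=; first by case=> _ [J WJ <-] <-.
by move=> WT; exists (T, T) => //; exists T.
Qed.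

Lemma total_viewP (At : Type) (W : belief_view At) (H T : interp At) :
  total_view W (H, T) <-> W T /\ H = T.
Proof.
split; first by case=> J WJ [<- <-].
by case=> WT ->; exists T.
Qed.

Lemma ht_belief_view_total (At : Type) (W : belief_view At) :
  W !=set0 -> ht_belief_view (total_view W).
Proof.
case=> T WT; split; first by exists (T, T), T.
by move=> H J /total_viewP[_ ->].
Qed.

(** A total view is the total view of its own there-components, so both halves of an implication
    become the same classical condition. *)
Lemma bsat_total (At : Type) (W : belief_view At) (f : form At) (T : interp At) :
  bsat (total_view W) T T f <-> sat W T f.
Proof.
elim: f T => [|a|f IHf g IHg|f IHf g IHg|f IHf g IHg|f IHf] T //=;
  rewrite ?there_total_view ?(propext (IHf T)) ?(propext (IHg T)) //.
- by split=> [[]|].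
- split=> [h J WJ|h H J /total_viewP[WJ ->]].
    by apply/IHf/h/total_viewP.
  by apply/IHf/h.
Qed.

Lemma osat_reduct (At : Type) (W : belief_view At) (f : form At) (T : interp At) :
  osat T (reduct_form W f) <-> sat W T f.
Proof.
elim: f => [|a|f IHf g IHg|f IHf g IHg|f IHf g IHg|f IHf] //=;
  rewrite ?(propext IHf) ?(propext IHg) //.
by case: asboolP => [h|h] /=; split=> //; left.
Qed.

Lemma ht_sat_reduct (At : Type) (W : belief_view At) (f : form At)
    (H T : interp At) :
  ht_sat H T (reduct_form W f) <-> bsat (total_view W) H T f.
Proof.
elim: f => [|a|f IHf g IHg|f IHf g IHg|f IHf g IHg|f IHf] //=;
  rewrite ?(propext IHf) ?(propext IHg) //.
- rewrite there_total_view !(propext (osat_reduct _ _ _ _)).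
  by rewrite !(propext (bsat_total _ _ _ _)); split=> -[].
(* Over a total view a subjective formula has one truth value, whatever [H] and [T] are: the
   constant that the reduct substitutes. *)
- have -> : (forall Hi Ti, total_view W (Hi, Ti) ->
              bsat (total_view W) Hi Ti f) = sat_L W f.
    apply/propext; split=> [h J WJ|h Hi J /total_viewP[WJ ->]].
      by apply/bsat_total/h/total_viewP.
    by apply/bsat_total/h.
  by case: asboolP => [h|h] /=; split=> // _; split; left.
Qed.

(** * Belief in literals, bodies and rules *)

Lemma bsat_persistent (At : Type) (V : ht_view At) (f : form At)
    (H T : interp At) :
  ht_belief_view V -> H `<=` T -> bsat V H T f -> sat (there_view V) T f.
Proof.
move=> [V0 VHT].
elim: f H T => [|a|f IHf g IHg|f IHf g IHg|f IHf g IHg|f IHf] H T HT //=.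
- exact: HT.
- by move=> [/(IHf _ _ HT) ? /(IHg _ _ HT)].
- by move=> [/(IHf _ _ HT)|/(IHg _ _ HT)]; [left|right].
(* The there half of an implication is already its classical truth at [there_view V]. *)
- by rewrite !(propext (bsat_total _ _ _ _)); case.
- by move=> h _ [[Hi Ti] VHi <-] /=; apply: (IHf Hi); [exact: VHT|exact: h].
Qed.

(** By persistence, classical falsity of [f] entails disbelief in it, so the there half alone
    decides a negation. Hence only positive literals constrain the here-components. *)
Lemma bsat_neg (At : Type) (V : ht_view At) (f : form At) (H T : interp At) :
  ht_belief_view V -> H `<=` T ->
  bsat V H T (FNeg f) <-> ~ sat (there_view V) T f.
Proof.
move=> hV HT /=; rewrite (propext (bsat_total _ _ _ _)).
split=> [[_ []] //|nf]; split; left=> // Vf.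
exact/nf/(bsat_persistent _ _ _ _ _ hV HT).
Qed.

Lemma sat_neg (At : Type) (W : belief_view At) (f : form At) (T : interp At) :
  sat W T (FNeg f) <-> ~ sat W T f.
Proof. by split=> [[]|] //=; left. Qed.

Lemma bsat_objlit (At : Type) (V : ht_view At) (l : objlit At)
    (H T : interp At) :
  ht_belief_view V -> H `<=` T ->
  bsat V H T (objlit_form l) <->
  sat (there_view V) T (objlit_form l) /\ (forall a, l = OLPos a -> H a).
Proof.
move=> hV HT; case: l => a.
- split=> [Ha|[_]]; last exact.
  by split=> [|_ [<-]]; [exact: HT|].
- rewrite (propext (bsat_neg _ _ _ _ _ hV HT)) (propext (sat_neg _ _ _ _)).
  by split=> [|[]].
- rewrite (propext (bsat_neg _ _ _ _ _ hV HT)) (propext (sat_neg _ _ (FNeg _) _)).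
  by split=> [|[]].
Qed.

Lemma bsat_literal (At : Type) (V : ht_view At) (B : literal At)
    (H T : interp At) :
  ht_belief_view V -> H `<=` T ->
  bsat V H T (literal_form B) <->
  [/\ sat (there_view V) T (literal_form B),
      forall a, B = LObj (OLPos a) -> H a
    & forall a, B = LSub (OLPos a) -> forall Hi Ti, V (Hi, Ti) -> Hi a].
Proof.
move=> hV HT; have [_ VHT] := hV; case: B => l.
- rewrite (propext (bsat_objlit _ _ _ _ _ hV HT)); split.
    by move=> [? h]; split=> // a [/h].
  by move=> [? h _]; split=> // a la; apply: h; rewrite la.
- split=> [h|[h _ hH] Hi Ti VHi].
    split=> //; first exact: (bsat_persistent _ _ _ _ _ hV HT).
    by move=> a [la] Hi Ti /h; rewrite la.
  apply/(bsat_objlit _ _ _ _ _ hV (VHT _ _ VHi)); split.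
    by apply: h; exists (Hi, Ti).
  by move=> a la; apply: hH VHi; rewrite la.
- rewrite (propext (bsat_neg _ _ _ _ _ hV HT)) (propext (sat_neg _ _ _ _)).
  by split=> [|[]].
- rewrite (propext (bsat_neg _ _ _ _ _ hV HT)) (propext (sat_neg _ _ (FNeg _) _)).
  by split=> [|[]].
Qed.

Lemma bsat_big_and (At : Type) (V : ht_view At) (H T : interp At)
    (s : seq (form At)) :
  bsat V H T (big_and s) <-> forall f, List.In f s -> bsat V H T f.
Proof.
elim: s => [|f [|g s] IHs]; first by split=> // _; split; left.
  by split=> [? _ [<-|[]]|h] //; apply: h; left.
change (big_and [:: f, g & s]) with (FAnd f (big_and (g :: s))).
split=> [[hf /IHs hs] k [<-|/hs]|h] //.
by split; [apply: h; left | apply/IHs => k sk; apply: h; right].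
Qed.

Lemma sat_big_and (At : Type) (W : belief_view At) (T : interp At)
    (s : seq (form At)) :
  sat W T (big_and s) <-> forall f, List.In f s -> sat W T f.
Proof.
rewrite -(propext (bsat_total _ _ _ _)) (propext (bsat_big_and _ _ _ _ _)).
by split=> h f /h /bsat_total.
Qed.

(** With [H] equal to [T] minus [X], these conjuncts match the body conditions of [unfounded_set]:
    once the body holds classically, an atom of [Body_ob_pos r] is in [H] exactly when it avoids
    [X], and likewise for [Body_sub_pos r] over all members of the view. *)
Lemma bsat_body (At : Type) (V : ht_view At) (r : rule At) (H T : interp At) :
  ht_belief_view V -> H `<=` T ->
  bsat V H T (body_form r) <->
  [/\ sat (there_view V) T (body_form r),
      Body_ob_pos r `<=` H
    & forall Hi Ti, V (Hi, Ti) -> Body_sub_pos r `<=` Hi].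
Proof.
move=> hV HT; rewrite /body_form (propext (bsat_big_and _ _ _ _ _)).
rewrite (propext (sat_big_and _ _ _ _)).
have bodyP (Q : form At -> Prop) :
    (forall f, List.In f (map (@literal_form At) (rule_body r)) -> Q f) <->
    forall B, List.In B (rule_body r) -> Q (literal_form B).
  split=> [h B rB|h f /(List.in_map_iff _ _ _)[B [<- /h]]] //.
  exact/h/List.in_map.
rewrite !(propext (bodyP _)); split.
  move=> h; split=> [B /h/(bsat_literal _ _ _ _ _ hV HT)[]|a ra|Hi Ti VHi a ra] //.
    by case/(bsat_literal _ _ _ _ _ hV HT): (h _ ra) => _ hob _; exact: hob.
  by case/(bsat_literal _ _ _ _ _ hV HT): (h _ ra) => _ _ hsub; exact: hsub VHi.
move=> [hs hob hsub] B rB; apply/(bsat_literal _ _ _ _ _ hV HT).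
split=> [|a Ba|a Ba Hi Ti VHi]; first exact: hs.
  by apply: hob; rewrite /Body_ob_pos /= -Ba.
by apply: (hsub _ _ VHi); rewrite /Body_sub_pos /= -Ba.
Qed.

Lemma bsat_head (At : Type) (V : ht_view At) (r : rule At) (H T : interp At) :
  bsat V H T (head_form r) <-> Head r `&` H !=set0.
Proof.
rewrite /head_form /Head; elim: (rule_head r) => [|a [|b s] IHs].
- by split=> // -[? []].
- by split=> [Ha|[_ [/= [<-|[]]]]] //; exists a; split=> //; left.
- change (big_or _) with (FOr (FAtom a) (big_or (map (@FAtom At) (b :: s)))).
  split=> [[Ha|/IHs[c [sc Hc]]]|[c [/= [<-|sc] Hc]]].
  + by exists a; split=> //; left.
  + by exists c; split=> //; right.
  + by left.
  + by right; apply/IHs; exists c.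
Qed.

Lemma bsat_rule (At : Type) (V : ht_view At) (r : rule At) (H T : interp At) :
  bsat V H T (rule_form r) <->
  (bsat V H T (body_form r) -> Head r `&` H !=set0) /\
  sat (there_view V) T (rule_form r).
Proof.
rewrite /= -!implyE !(propext (bsat_total _ _ _ _)).
by rewrite (propext (bsat_head _ _ _ _ _)).
Qed.

Lemma sat_rule_head (At : Type) (W : belief_view At) (r : rule At)
    (T : interp At) :
  sat W T (rule_form r) -> sat W T (body_form r) -> Head r `&` T !=set0.
Proof.
move=> [//|/bsat_total/bsat_head h _]; exact: h.
Qed.

(** * Minimality below a total belief interpretation *)

Lemma ble_total (At : Type) (V : ht_view At) (W : belief_view At)
    (H J T : interp At) :
  ble (BTriple V H J) (total_btriple W T) ->
  [/\ J = T, H `<=` T & there_view V = W].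
Proof.
move=> [/= JT HT WV VW]; split=> //; apply/seteqP; split.
  by move=> _ [[Hi Ti] /VW[K [/total_viewP[WT _] _]] <-].
move=> Ti WTi; have [|K [VK _]] := WV Ti Ti; first exact/total_viewP.
by exists (K, Ti).
Qed.

Lemma total_blt (At : Type) (V : ht_view At) (W : belief_view At)
    (H T : interp At) :
  ht_belief_view V -> there_view V = W -> H `<=` T ->
  (V <> total_view W \/ H <> T) ->
  blt (BTriple V H T) (total_btriple W T).
Proof.
move=> [_ VHT] VW HT ne; split; last by case=> ? ?; case: ne.
split=> //= [Hi Ti /total_viewP[]|Hi Ti VHi].
  by rewrite -VW => -[[K L] VK /= <-] ->; exists K; split=> //; exact: VHT VK.
exists Ti; split; last exact: VHT VHi.
by apply/total_viewP; rewrite -VW; split=> //; exists (Hi, Ti).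
Qed.

Lemma nontotal_member (At : Type) (V : ht_view At) :
  V <> total_view (there_view V) -> exists H T, V (H, T) /\ H <> T.
Proof.
move=> neV; apply: contrapT => none; apply: neV.
have tot H T : V (H, T) -> H = T.
  by move=> VH; apply: contrapT => HT; apply: none; exists H, T.
apply/seteqP; split=> -[H T].
  by move=> VH; apply/total_viewP; split; [exists (H, T)|exact: tot].
by move=> /total_viewP[[[K L] VK /= <-] ->]; have := VK; rewrite {1}(tot _ _ VK).
Qed.

(** Stability takes the shape of equilibrium minimality, but with the view frozen at [total_view W];
    equilibrium models also compete against views with smaller here-components. *)
Lemma stable_modelP (At : Type) (G : theory At) (W : belief_view At)
    (T : interp At) :
  stable_model (reduct W G) T <->
  (forall f, G f -> sat W T f) /\
  forall H, H `<=` T -> (forall f, G f -> bsat (total_view W) H T f) -> H = T.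
Proof.
split=> -[mT minT]; split.
- by move=> f Gf; apply/osat_reduct/mT; exists f.
- move=> H HT mH; apply: contrapT => neHT; apply: minT.
  exists H; split; last by move=> _ [f Gf <-]; apply/ht_sat_reduct/mH.
  by rewrite properEneq; split=> //; apply/eqP.
- by move=> _ [f Gf <-]; apply/osat_reduct/mT.
- move=> [H [ltHT mH]]; apply: (@properxx _ T); rewrite -{1}(minT H) //.
    exact: properW.
  by move=> f Gf; apply/ht_sat_reduct/mH; exists f.
Qed.

Lemma EQBP (At : Type) (G : theory At) (W : belief_view At) (T : interp At) :
  W !=set0 ->
  EQB G (W, T) <->
  [/\ forall f J, G f -> W J -> sat W J f,
      forall f, G f -> sat W T f
    & forall V H, ht_belief_view V -> there_view V = W -> H `<=` T ->
      (forall f Hi Ti, G f -> V (Hi, Ti) -> bsat V Hi Ti f) ->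
      (forall f, G f -> bsat V H T f) -> V = total_view W /\ H = T].
Proof.
move=> W0; split.
  move=> [[/= _ mW] minW]; split.
  - move=> f J Gf WJ; apply/bsat_total/mW => //; left; exact/total_viewP.
  - by move=> f Gf; apply/bsat_total/mW => //; right.
  - move=> V H hV VW HT mV mH.
    apply: contrapT => /not_andP ne; apply: minW.
    exists (BTriple V H T); split; last exact: total_blt.
    by split=> // f Gf Hi Ti [/mV|[-> ->]]; [exact|exact: mH].
move=> [mW mT minW]; split.
  split; first by split=> //; exact: ht_belief_view_total.
  move=> f Gf Hi Ti [/total_viewP[WT ->]|[-> ->]]; apply/bsat_total.
    exact: mW.
  exact: mT.
move=> [[V H J] [[[/= hV _] mV] [/ble_total[JT HT VW]]]]; apply.
rewrite JT in mV *; have [||-> -> //] := minW V H hV VW HT.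
- by move=> f Hi Ti Gf VHi; apply: mV => //; left.
- by move=> f Gf; apply: mV => //; right.
Qed.

Lemma EQB_stable_model (At : Type) (G : theory At) (W : belief_view At)
    (T : interp At) :
  W !=set0 -> EQB G (W, T) -> stable_model (reduct W G) T.
Proof.
move=> W0 /(EQBP _ _ _ _ W0)[mW mT minT]; apply/stable_modelP; split=> // H HT mH.
have [||] := minT (total_view W) H (ht_belief_view_total _ _ W0)
                  (there_total_view _ _) HT => //.
by move=> f Hi Ti Gf /total_viewP[WT ->]; apply/bsat_total/mW.
Qed.

(** * Equilibrium world views are founded G91-world views *)

Lemma equilibrium_world_view_G91 (At : Type) (G : theory At)
    (W : belief_view At) :
  equilibrium_world_view G W -> G91_world_view G W.
Proof.
move=> [[[[H0 T0] /total_viewP[WT0 _]] _] eqW].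
have W0 : W !=set0 by exists T0.
have WE T : W T = EQB G (W, T) by rewrite {1}eqW.
apply/seteqP; split=> T.
  by rewrite WE; exact: EQB_stable_model.
move=> /stable_modelP[mT minT]; rewrite WE; apply/EQBP => //.
have mW : forall f J, G f -> W J -> sat W J f.
  by move=> f J Gf; rewrite WE => /(EQBP _ _ _ _ W0)[_ mJ _]; exact: mJ.
split=> // V H hV VW HT mV mH.
(* A non-total member [(K, J)] of [V] would make the triple of [V], [K], [J] a belief model strictly
   below that of [W], [J], although [J] lies in [W]. So the view cannot shrink, and stability of [T]
   then settles [H]. *)
have VE : V = total_view W.
  apply: contrapT; rewrite -{1}VW => /nontotal_member[K [J [VK]]]; apply.
  have WJ : W J by rewrite -VW; exists (K, J).
  move: WJ; rewrite WE => /(EQBP _ _ _ _ W0)[_ _ minJ].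
  by have [] := minJ V K hV VW (hV.2 _ _ VK) mV (fun f Gf => mV f K J Gf VK).
by split=> //; apply: minT => // f Gf; rewrite -VE; exact: mH.
Qed.

Lemma equilibrium_world_view_founded (At : Type) (P : program At)
    (W : belief_view At) :
  equilibrium_world_view (program_theory P) W -> founded P W.
Proof.
move=> [[[[H0 T0] /total_viewP[WT0 _]] _] eqW] [U [[[[X0 I0] UX0] Uunf] UW]].
have W0 : W !=set0 by exists T0.
have WE T : W T = EQB (program_theory P) (W, T) by rewrite {1}eqW.
have [WI0 [a [X0a I0a]]] := UW _ _ UX0.
have := WI0; rewrite WE => /(EQBP _ _ _ _ W0)[mW _ minW].
pose V : ht_view At :=
  total_view W `|` [set p | exists2 X, U (X, p.2) & p.1 = p.2 `\` X].
have hV : ht_belief_view V.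
  split; first by exists (T0, T0); left; exact/total_viewP.
  by move=> H T [/total_viewP[_ ->] //|[X _ /= ->]]; exact: subDsetl.
have VW : there_view V = W.
  apply/seteqP; split; last first.
    by move=> T WT; exists (T, T) => //; left; exact/total_viewP.
  by move=> _ [[H T] [/total_viewP[WT _]|[X /UW[WT _] _]] <-].
have mV f H T : program_theory P f -> V (H, T) -> bsat V H T f.
  move=> [r Pr <-] VH.
  have WT : W T by rewrite -VW; exists (H, T).
  have mr : sat W T (rule_form r) by apply: mW => //; exists r.
  apply/bsat_rule; rewrite VW; split=> //.
  move=> /(bsat_body _ _ _ _ _ hV (hV.2 _ _ VH)); rewrite VW => -[sb obH subH].
  have [b [hb Tb]] := sat_rule_head _ _ _ _ mr sb.
  case: VH obH => [/total_viewP[_ ->] _|[X /= UX ->] obH]; first by exists b.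
  (* If the head missed [T] minus [X], the rule [r] would meet every condition that unfoundedness
     forbids; the head atom [b], true in [T], must then lie in [X]. *)
  apply: contrapT => noH.
  have Xb : X b by apply: contrapT => nXb; apply: noH; exists b.
  apply: (Uunf _ _ UX); exists r; split; first by split=> //; exists b.
  split=> //.
  - by rewrite -subset0 => c [/obH[]].
  - by rewrite -subset0 => c [[hc nXc] Tc]; apply: noH; exists c.
  (* A positive subjective atom belongs to every here-component, in particular to [I'] minus [X'],
     so it avoids the whole union [Y]. *)
  - rewrite -subset0 => c [rc [[X' I'] UX' X'c]].
    have VX' : V (I' `\` X', I') by right; exists X'.
    by have [] := subH _ _ VX' _ rc.
(* Taking this member as the distinguished pair too, minimality forces [I0] minus [X0] to equal
   [I0], against the common atom [a]. *)
have V0 : V (I0 `\` X0, I0) by right; exists X0.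
have [|_ E] := minW V (I0 `\` X0) hV VW (@subDsetl _ _ _) mV.
  by move=> f Pf; exact: mV.
by have [] : (I0 `\` X0) a by rewrite E.
Qed.

(** * Foundedness gives minimality *)

Lemma founded_minimal (At : Type) (P : program At) (W : belief_view At)
    (T : interp At) (V : ht_view At) (H : interp At) :
  founded P W -> W T -> ht_belief_view V -> there_view V = W -> H `<=` T ->
  (forall f Hi Ti, program_theory P f -> V (Hi, Ti) -> bsat V Hi Ti f) ->
  (forall f, program_theory P f -> bsat V H T f) ->
  V = total_view W /\ H = T.
Proof.
move=> fW WT hV VW HT mV mH; apply: contrapT => ne; apply: fW.
(* The model may differ from the total one only at its distinguished pair. Adding that pair to the
   candidates treats both cases at once; belief is still evaluated in [V], and [T] in [W] keeps all
   there-components in [W]. *)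
pose V' : ht_view At := V `|` [set (H, T)].
have mV' f Hi Ti : program_theory P f -> V' (Hi, Ti) -> bsat V Hi Ti f.
  by move=> Pf [VHi|[-> ->]]; [exact: mV|exact: mH].
have V'HT Hi Ti : V' (Hi, Ti) -> Hi `<=` Ti.
  by move=> [VHi|[-> ->]] //; exact: (hV.2 _ _ VHi).
have V'W Hi Ti : V' (Hi, Ti) -> W Ti.
  by move=> [VHi|[_ ->]] //; rewrite -VW; exists (Hi, Ti).
have [K [J [V'K neKJ]]] : exists K J, V' (K, J) /\ K <> J.
  case/not_andP: ne => [|neHT]; last by exists H, T; split=> //; right.
  rewrite -{1}VW => /nontotal_member[K [J [VK neKJ]]].
  by exists K, J; split=> //; left.
(* Excluding total pairs ensures that each [X] meets its [I]. *)
exists [set p | exists Hi, [/\ V' (Hi, p.2), Hi <> p.2 & p.1 = p.2 `\` Hi]].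
split; last first.
  move=> _ I [Hi [/= V'Hi neHi ->]]; split; first exact: V'W V'Hi.
  apply: contrapT => none; apply: neHi; apply/seteqP.
  split; first exact: V'HT V'Hi.
  by move=> a Ia; apply: contrapT => nHa; apply: none; exists a.
split; first by exists (J `\` K, J), K.
move=> _ I [Hi [/= V'Hi neHi ->]] [r [[Pr _] [sb obX hX subY]]].
have rP : program_theory P (rule_form r) by exists r.
have [hr _] := (bsat_rule _ _ _ _ _).1 (mV' _ _ _ rP V'Hi).
(* A believed head atom would lie in [I] but outside [X], against the third condition. It remains to
   show that the other conditions make the body believed at [Hi], [I]. *)
have [|b [rb Hib]] := hr; last first.
  suff : set0 b by [].
  by rewrite -hX; split; [split=> // -[]|exact: V'HT V'Hi _ Hib].
apply/(bsat_body _ _ _ _ _ hV (V'HT _ _ V'Hi)); rewrite VW; split=> //.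
- move=> a ra; apply: contrapT => nHa; suff : set0 a by [].
  rewrite -obX; split=> //; split=> //.
  move/sat_big_and: sb => /(_ (FAtom a)); apply.
  exact: (List.in_map (@literal_form At) _ _ ra).
(* Classical truth of the body puts [a] in [Tj]; were it missing from [Hj], the pair would be
   non-total and would contribute [a] to the union [Y]. *)
- move=> Hj Tj VHj a ra; apply: contrapT => nHa; suff : set0 a by [].
  have Tja : Tj a.
    have WTj : W Tj by rewrite -VW; exists (Hj, Tj).
    move/sat_big_and: sb => /(_ (FL (FAtom a))) sa.
    apply: (sa _ Tj WTj).
    exact: (List.in_map (@literal_form At) _ _ ra).
  rewrite -subY; split=> //; exists (Tj `\` Hj, Tj) => //=.
  exists Hj; split=> //; first by left.
  by move=> E; apply: nHa; rewrite E.
Qed.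

(* Equilibrium world views are only defined for non-empty belief views. *)
Theorem mainTheorem1 (At : Type) (P : program At) (W : belief_view At)
    (W_nonempty : W !=set0) :
  equilibrium_world_view (program_theory P) W <->
  G91_world_view (program_theory P) W /\ founded P W.
Proof.
split=> [eW|[gW fW]].
  by split; [exact: equilibrium_world_view_G91
            |exact: equilibrium_world_view_founded].
split; first exact: ht_belief_view_total.
have WE T : W T = stable_model (reduct W (program_theory P)) T by rewrite {1}gW.
(* Equilibrium models are stable, hence in [W]; the inclusion of [W] in the equilibrium models is
   where foundedness enters. *)
apply/seteqP; split=> T; last by rewrite WE; exact: EQB_stable_model.
have mW f J : program_theory P f -> W J -> sat W J f.
  by move=> Pf; rewrite WE => /stable_modelP[mJ _]; exact: mJ.
move=> WT; apply/EQBP => //; split=> // [f Pf|V H]; first exact: mW.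
exact: founded_minimal.
Qed.
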